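(* Let $R$ be a commutative unital ring, $\mathcal{A}$ a commutative unital $R$-algebra, and $(\mathcal{M},a)$ an anchored $\mathcal{A}$-module. Let $\overline{T}\mathcal{M}=\bigoplus_{k\ge 1}\mathcal{M}^{\otimes_R k}$ be the reduced tensor $R$-module over the $R$-module $\mathcal{M}$, endowed with the $\mathcal{A}$-module structure that extends the given one on $\mathcal{M}$ and is defined inductively by $$f(m_1\otimes m_2\otimes\cdots\otimes m_n):=m_1\otimes f(m_2\otimes\cdots\otimes m_n)-a(m_1)(f)(m_2\otimes\cdots\otimes m_n)\qquad(f\in\mathcal{A},\ m_i\in\mathcal{M},\ n\ge 2),$$ let $[-,-]_{\mathrm{Lei}}$ be the universal Leibniz bracket on $\overline{T}\mathcal{M}$, and let $\mathrm{F}a:\overline{T}\mathcal{M}\to\mathrm{Der}\,\mathcal{A}$ be the map induced by $a:\mathcal{M}\to\mathrm{Der}\,\mathcal{A}$, i.e. the unique Leibniz $R$-algebra morphism extending $a$. Then the triple $\mathrm{F}\mathcal{M}=(\overline{T}\mathcal{M},[-,-]_{\mathrm{Lei}},\mathrm{F}a)$, together with the inclusion $i:\mathcal{M}\hookrightarrow\overline{T}\mathcal{M}$, is the free Leibniz pseudoalgebra over $(R,\mathcal{A})$ on the anchored module $(\mathcal{M},a)$.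
   Context: $\mathrm{Der}\,\mathcal{A}$ is the $\mathcal{A}$-module of ($R$-linear) derivations of $\mathcal{A}$, with the commutator bracket. An anchored module over $\mathcal{A}$ is an $\mathcal{A}$-module $\mathcal{E}$ with an $\mathcal{A}$-linear map $a:\mathcal{E}\to\mathrm{Der}\,\mathcal{A}$; a morphism of anchored modules $(\mathcal{E}_1,a_1)\to(\mathcal{E}_2,a_2)$ is an $\mathcal{A}$-linear map $\phi$ with $a_2\phi=a_1$. A (left) Leibniz bracket on an $R$-module is an $R$-bilinear bracket with $[X,[Y,Z]]=[[X,Y],Z]+[Y,[X,Z]]$; it makes the $R$-module a Leibniz $R$-algebra, and Leibniz $R$-algebra morphisms are $R$-linear maps respecting the brackets. A Leibniz pseudoalgebra over $(R,\mathcal{A})$ is an anchored module $(\mathcal{E},a)$ over $\mathcal{A}$ with a Leibniz $R$-algebra structure $[-,-]$ such that, for all $f\in\mathcal{A}$, $X,Y\in\mathcal{E}$: $[X,fY]=f[X,Y]+a(X)(f)Y$ and $a[X,Y]=[a(X),a(Y)]$. A morphism of Leibniz pseudoalgebras $(\mathcal{E}_1,[-,-]_1,a_1)\to(\mathcal{E}_2,[-,-]_2,a_2)$ over $(R,\mathcal{A})$ is an $\mathcal{A}$-linear map $\phi$ with $a_2\phi=a_1$ and $\phi[X,Y]_1=[\phi X,\phi Y]_2$. For an $R$-module $V$, the universal Leibniz bracket on $\overline{T}V=\bigoplus_{k\ge1}V^{\otimes_R k}$ is the Leibniz bracket determined by $v_1\otimes v_2\otimes\cdots\otimes v_k=[v_1,[v_2,\ldots,[v_{k-2},[v_{k-1},v_k]]\ldots]]$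 for $v_i\in V$; with it $\overline{T}V$ is the free Leibniz $R$-algebra over $V$. A free Leibniz pseudoalgebra on an anchored module $\mathcal{M}$ is a Leibniz pseudoalgebra $\mathrm{F}\mathcal{M}$ over $(R,\mathcal{A})$ together with an anchored module morphism $i:\mathcal{M}\to \mathrm{F}\mathcal{M}$ such that, for any Leibniz pseudoalgebra $\mathcal{E}$ over $(R,\mathcal{A})$ and any anchored module morphism $\phi:\mathcal{M}\to\mathcal{E}$, there is a unique Leibniz pseudoalgebra morphism $\Phi:\mathrm{F}\mathcal{M}\to\mathcal{E}$ with $\Phi\, i=\phi$. *)

(* Defs.v *)
From HB Require Import structures.
From mathcomp Require Import all_boot all_order all_algebra.
From mathcomp Require Import boolp.

Set Implicit Arguments.
Unset Strict Implicit.
Unset Printing Implicit Defensive.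

Import GRing.Theory.
Local Open Scope ring_scope.
Local Open Scope quotient_scope.

(* A commutative R-algebra is given by its structure morphism                 *)
(* iota : {rmorphism R -> A}: unlike comAlgType R, this allows A = 0.  The    *)
(* R-module underlying an A-module M is restr iota M.                         *)

Definition restr (R A : comPzRingType) (iota : {rmorphism R -> A})
  (M : Type) : Type := M.

Section RestrictionOfScalars.
Variables (R A : comPzRingType) (iota : {rmorphism R -> A}) (M : lmodType A).
Local Notation rM := (restr iota M).

HB.instance Definition _ := GRing.Zmodule.copy rM M.

Let rscale (r : R) (x : rM) : rM := iota r *: (x : M).

Fact restr_scaleA r s x : rscale r (rscale s x) = rscale (r * s) x.
Proof. by rewrite /rscale scalerA rmorphM. Qed.
Fact restr_scale1 : left_id 1 rscale.
Proof. by move=> x; rewrite /rscale rmorph1 scale1r. Qed.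
Fact restr_scaleDr : right_distributive rscale +%R.
Proof. by move=> r x y; rewrite /rscale scalerDr. Qed.
Fact restr_scaleDl x : {morph rscale^~ x : r s / r + s}.
Proof. by move=> r s; rewrite /rscale rmorphD scalerDl. Qed.

HB.instance Definition _ := GRing.Zmodule_isLmodule.Build R rM
  restr_scaleA restr_scale1 restr_scaleDr restr_scaleDl.

End RestrictionOfScalars.

Section TensorProduct.
Variables (R : comPzRingType) (V W : lmodType R).

(* The sequence [:: (v1, w1); ...; (vn, wn)] stands for                       *)
(* v1 (x) w1 + ... + vn (x) wn, so V (x)_R W is the quotient of the free      *)
(* commutative monoid on V * W by the bilinearity relations.  No formal       *)
(* coefficients are needed because -(v (x) w) = (- v) (x) w.  As inverses are *)
(* not formal, 0 (x) w = 0 is a relation of its own.                          *)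
Inductive tensor_rel : seq (V * W) -> seq (V * W) -> Prop :=
| tensor_refl s : tensor_rel s s
| tensor_sym s t : tensor_rel s t -> tensor_rel t s
| tensor_trans s t u : tensor_rel s t -> tensor_rel t u -> tensor_rel s u
| tensor_cat s s' t t' :
    tensor_rel s s' -> tensor_rel t t' -> tensor_rel (s ++ t) (s' ++ t')
| tensor_catC s t : tensor_rel (s ++ t) (t ++ s)
| tensor_zero w : tensor_rel [:: (0, w)] [::]
| tensor_addl v v' w : tensor_rel [:: (v + v', w)] [:: (v, w); (v', w)]
| tensor_addr v w w' : tensor_rel [:: (v, w + w')] [:: (v, w); (v, w')]
| tensor_balanced r v w : tensor_rel [:: (r *: v, w)] [:: (v, r *: w)].

Definition tensor_eqv (s t : seq (V * W)) : bool := `[< tensor_rel s t >].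

Fact tensor_eqv_refl : reflexive tensor_eqv.
Proof. by move=> s; apply/asboolP; exact: tensor_refl. Qed.
Fact tensor_eqv_sym : symmetric tensor_eqv.
Proof.
by move=> s t; apply/asboolP/asboolP => st; exact: tensor_sym.
Qed.
Fact tensor_eqv_trans : transitive tensor_eqv.
Proof.
move=> t s u /asboolP st /asboolP tu; apply/asboolP.
exact: tensor_trans st tu.
Qed.
Canonical tensor_equiv :=
  EquivRel tensor_eqv tensor_eqv_refl tensor_eqv_sym tensor_eqv_trans.

Definition tensor := {eq_quot tensor_eqv}.

HB.instance Definition _ := Choice.on tensor.
HB.instance Definition _ := EqQuotient.on tensor.

Definition tensor_mk (s : seq (V * W)) : tensor := \pi s.
Definition tens (v : V) (w : W) : tensor := tensor_mk [:: (v, w)].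

Lemma tensor_mkP s t : tensor_mk s = tensor_mk t <-> tensor_rel s t.
Proof.
split; first by move/eqmodP/asboolP.
by move=> st; apply/eqmodP/asboolP.
Qed.

Lemma tensor_mkK x : tensor_mk (repr x) = x.
Proof. exact: reprK. Qed.

Let scal_seq (r : R) (s : seq (V * W)) := [seq (r *: p.1, p.2) | p <- s].

Let scal_seq_rel r s t :
  tensor_rel s t -> tensor_rel (scal_seq r s) (scal_seq r t).
Proof.
elim=> [u|u w _|u w z _ + _|u u' w w' _ + _|u w|w|v v' w|v w w'|k v w].
- exact: tensor_refl.
- exact: tensor_sym.
- exact: tensor_trans.
- by rewrite /scal_seq !map_cat; exact: tensor_cat.
- by rewrite /scal_seq !map_cat; exact: tensor_catC.
- by rewrite /= scaler0; exact: tensor_zero.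
- by rewrite /= scalerDr; exact: tensor_addl.
- exact: tensor_addr.
- by rewrite /= scalerA mulrC -scalerA; exact: tensor_balanced.
Qed.

Definition tensor_add (x y : tensor) : tensor := tensor_mk (repr x ++ repr y).
Definition tensor_scale (r : R) (x : tensor) : tensor :=
  tensor_mk [seq (r *: p.1, p.2) | p <- repr x].

Let repr_rel s : tensor_rel (repr (tensor_mk s)) s.
Proof. by apply/tensor_mkP; rewrite tensor_mkK. Qed.

Lemma tensor_add_mk s t :
  tensor_add (tensor_mk s) (tensor_mk t) = tensor_mk (s ++ t).
Proof. by apply/tensor_mkP; apply: tensor_cat; exact: repr_rel. Qed.

Lemma tensor_scale_mk r s :
  tensor_scale r (tensor_mk s) = tensor_mk [seq (r *: p.1, p.2) | p <- s].
Proof. by apply/tensor_mkP; apply: scal_seq_rel; exact: repr_rel. Qed.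

Fact tensor_addA : associative tensor_add.
Proof.
move=> x y z; rewrite -(tensor_mkK x) -(tensor_mkK y) -(tensor_mkK z).
by rewrite !tensor_add_mk catA.
Qed.
Fact tensor_addC : commutative tensor_add.
Proof. by move=> x y; apply/tensor_mkP; exact: tensor_catC. Qed.
Fact tensor_add0 : left_id (tensor_mk [::]) tensor_add.
Proof. by move=> x; rewrite -(tensor_mkK x) tensor_add_mk. Qed.

Fact tensor_scaleDl_rel r r' s :
  tensor_rel (scal_seq (r + r') s) (scal_seq r s ++ scal_seq r' s).
Proof.
elim: s => [|[v w] s IHs]; first exact: tensor_refl.
rewrite /= scalerDl -[_ :: scal_seq (r + r') s]cat1s.
apply: tensor_trans (tensor_cat (tensor_addl _ _ _) IHs) _.
rewrite -[_ :: _ ++ _]cat1s -[_ :: scal_seq r' s]cat1s.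
rewrite -[[:: _; _]]/([:: (r *: v, w)] ++ [:: (r' *: v, w)]) -!catA.
apply: tensor_cat; first exact: tensor_refl.
rewrite !catA; apply: tensor_cat; last exact: tensor_refl.
exact: tensor_catC.
Qed.

Fact tensor_scale0_rel s : tensor_rel (scal_seq 0 s) [::].
Proof.
elim: s => [|[v w] s IHs]; first exact: tensor_refl.
rewrite /= scale0r -[_ :: _]cat1s -[[::]]/([::] ++ [::]).
by apply: tensor_cat IHs; exact: tensor_zero.
Qed.

Fact tensor_addN :
  left_inverse (tensor_mk [::]) (tensor_scale (- 1)) tensor_add.
Proof.
move=> x; rewrite -(tensor_mkK x) tensor_scale_mk tensor_add_mk.
apply/tensor_mkP; apply: tensor_trans (tensor_scale0_rel (repr x)).
have -> : 0 = - 1 + 1 :> R by rewrite addNr.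
apply: tensor_trans (tensor_sym (tensor_scaleDl_rel _ _ _)).
apply: tensor_cat; first exact: tensor_refl.
have -> : scal_seq 1 (repr x) = repr x; last exact: tensor_refl.
by rewrite /scal_seq -[RHS]map_id; apply: eq_map => -[v w]; rewrite scale1r.
Qed.

HB.instance Definition _ := GRing.isZmodule.Build tensor
  tensor_addA tensor_addC tensor_add0 tensor_addN.

Fact tensor_scaleA r r' x :
  tensor_scale r (tensor_scale r' x) = tensor_scale (r * r') x.
Proof.
rewrite -(tensor_mkK x) !tensor_scale_mk -map_comp; congr tensor_mk.
by apply: eq_map => -[v w]; rewrite /= scalerA.
Qed.
Fact tensor_scale1 : left_id 1 tensor_scale.
Proof.
move=> x; rewrite -(tensor_mkK x) tensor_scale_mk; congr tensor_mk.
by rewrite -[RHS]map_id; apply: eq_map => -[v w]; rewrite scale1r.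
Qed.
Fact tensor_scaleDr : right_distributive tensor_scale +%R.
Proof.
move=> r x y; rewrite -(tensor_mkK x) -(tensor_mkK y) [_ + _]tensor_add_mk.
by rewrite !tensor_scale_mk [RHS]tensor_add_mk map_cat.
Qed.
Fact tensor_scaleDl x : {morph tensor_scale^~ x : r r' / r + r'}.
Proof.
move=> r r'; rewrite -(tensor_mkK x) !tensor_scale_mk [RHS]tensor_add_mk.
by apply/tensor_mkP; exact: tensor_scaleDl_rel.
Qed.

HB.instance Definition _ := GRing.Zmodule_isLmodule.Build R tensor
  tensor_scaleA tensor_scale1 tensor_scaleDr tensor_scaleDl.

End TensorProduct.

Section DirectSum.
Variables (R : comPzRingType) (P : nat -> lmodType R).

Record dsum := DSum {
  dsum_fun :> forall k, P k;
  dsum_finite : exists N, forall k, (N <= k)%N -> dsum_fun k = 0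
}.

Lemma dsum_eq (x y : dsum) : (forall k, x k = y k) -> x = y.
Proof.
case: x y => [x hx] [y hy] /= xy.
have {}xy : x = y by apply: functional_extensionality_dep.
by case: _ / xy in hy *; congr DSum; exact: Prop_irrelevance.
Qed.

HB.instance Definition _ := gen_eqMixin dsum.
HB.instance Definition _ := gen_choiceMixin dsum.

Fact dsum_zero_finite :
  exists N, forall k, (N <= k)%N -> (fun k => 0 : P k) k = 0.
Proof. by exists 0%N. Qed.
Fact dsum_opp_finite (x : dsum) :
  exists N, forall k, (N <= k)%N -> (fun k => - x k) k = 0.
Proof.
by have [N xN] := dsum_finite x; exists N => k /xN ->; rewrite oppr0.
Qed.
Fact dsum_add_finite (x y : dsum) :
  exists N, forall k, (N <= k)%N -> (fun k => x k + y k) k = 0.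
Proof.
have [N xN] := dsum_finite x; have [N' yN'] := dsum_finite y.
exists (maxn N N') => k; rewrite geq_max => /andP[/xN -> /yN' ->].
by rewrite addr0.
Qed.
Fact dsum_scale_finite (r : R) (x : dsum) :
  exists N, forall k, (N <= k)%N -> (fun k => r *: x k) k = 0.
Proof.
by have [N xN] := dsum_finite x; exists N => k /xN ->; rewrite scaler0.
Qed.

Definition dsum_zero := DSum dsum_zero_finite.
Definition dsum_opp x := DSum (dsum_opp_finite x).
Definition dsum_add x y := DSum (dsum_add_finite x y).
Definition dsum_scale r x := DSum (dsum_scale_finite r x).

Fact dsum_addA : associative dsum_add.
Proof. by move=> x y z; apply: dsum_eq => k; exact: addrA. Qed.
Fact dsum_addC : commutative dsum_add.
Proof. by move=> x y; apply: dsum_eq => k; exact: addrC. Qed.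
Fact dsum_add0 : left_id dsum_zero dsum_add.
Proof. by move=> x; apply: dsum_eq => k; exact: add0r. Qed.
Fact dsum_addN : left_inverse dsum_zero dsum_opp dsum_add.
Proof. by move=> x; apply: dsum_eq => k; exact: addNr. Qed.

HB.instance Definition _ := GRing.isZmodule.Build dsum
  dsum_addA dsum_addC dsum_add0 dsum_addN.

Fact dsum_scaleA r s x : dsum_scale r (dsum_scale s x) = dsum_scale (r * s) x.
Proof. by apply: dsum_eq => k; exact: scalerA. Qed.
Fact dsum_scale1 : left_id 1 dsum_scale.
Proof. by move=> x; apply: dsum_eq => k; exact: scale1r. Qed.
Fact dsum_scaleDr : right_distributive dsum_scale +%R.
Proof. by move=> r x y; apply: dsum_eq => k; exact: scalerDr. Qed.
Fact dsum_scaleDl x : {morph dsum_scale^~ x : r s / r + s}.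
Proof. by move=> r s; apply: dsum_eq => k; exact: scalerDl. Qed.

HB.instance Definition _ := GRing.Zmodule_isLmodule.Build R dsum
  dsum_scaleA dsum_scale1 dsum_scaleDr dsum_scaleDl.

End DirectSum.

Section ReducedTensorModule.
Variables (R : comPzRingType) (V : lmodType R).

(* Index shift: tensor_pow k is the (k+1)-st tensor power of V. *)
Fixpoint tensor_pow (k : nat) : lmodType R :=
  if k is k'.+1 then tensor V (tensor_pow k') else V.

Definition Tbar : Type := dsum tensor_pow.

HB.instance Definition _ := GRing.Lmodule.on Tbar.

Definition Tbar_incl_fun (v : V) (k : nat) : tensor_pow k :=
  if k is k'.+1 then 0 else v.
Fact Tbar_incl_finite v :
  exists N, forall k, (N <= k)%N -> Tbar_incl_fun v k = 0.
Proof. by exists 1%N => -[]. Qed.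
Definition Tbar_incl (v : V) : Tbar := DSum (Tbar_incl_finite v).

Definition Tbar_cons_fun (v : V) (x : Tbar) (k : nat) : tensor_pow k :=
  if k is k'.+1 then tens v (x k') else 0.
Fact Tbar_cons_finite v x :
  exists N, forall k, (N <= k)%N -> Tbar_cons_fun v x k = 0.
Proof.
have [N xN] := dsum_finite x; exists N.+1 => -[|k] //= /xN ->.
apply/tensor_mkP; apply: tensor_trans (tensor_zero _ 0).
by rewrite -{1}(scale0r 0) -(scale0r v); exact/tensor_sym/tensor_balanced.
Qed.
(* v (x) x for an arbitrary, not necessarily homogeneous, x *)
Definition Tbar_cons (v : V) (x : Tbar) : Tbar := DSum (Tbar_cons_finite v x).

(* pure_tensor v [:: v2; ...; vn] is v (x) v2 (x) ... (x) vn *)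
Fixpoint pure_tensor (v : V) (s : seq V) : Tbar :=
  if s is w :: s' then Tbar_cons v (pure_tensor w s') else Tbar_incl v.

End ReducedTensorModule.

Section LeibnizAlgebras.
Variable R : comPzRingType.

Record is_leibniz_bracket (V : lmodType R) (br : V -> V -> V) : Prop := {
  leibniz_linl : forall y, linear (br^~ y);
  leibniz_linr : forall x, linear (br x);
  leibniz_id : forall x y z, br x (br y z) = br (br x y) z + br y (br x z)
}.

Definition is_leibniz_morphism (V W : lmodType R) (brV : V -> V -> V)
    (brW : W -> W -> W) (phi : V -> W) : Prop :=
  linear phi /\ forall x y, phi (brV x y) = brW (phi x) (phi y).

(* iterated_bracket br v [:: v2; ...; vn] is [v, [v2, ..., [v(n-1), vn]...]] *)
Fixpoint iterated_bracket (V : lmodType R) (br : Tbar V -> Tbar V -> Tbar V)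
    (v : V) (s : seq V) : Tbar V :=
  if s is w :: s' then br (Tbar_incl v) (iterated_bracket br w s')
  else Tbar_incl v.

Definition is_universal_leibniz_bracket (V : lmodType R)
    (br : Tbar V -> Tbar V -> Tbar V) : Prop :=
  is_leibniz_bracket br /\
  forall v s, pure_tensor v s = iterated_bracket br v s.

End LeibnizAlgebras.

Section Derivations.
Variables (R A : comPzRingType) (iota : {rmorphism R -> A}).

Record Der := Derivation {
  der_fun :> A -> A;
  derD : forall f g, der_fun (f + g) = der_fun f + der_fun g;
  derZ : forall r f, der_fun (iota r * f) = iota r * der_fun f;
  derM : forall f g, der_fun (f * g) = der_fun f * g + f * der_fun g
}.

Implicit Types D : Der.

Lemma der_eq D1 D2 : (forall f, D1 f = D2 f) -> D1 = D2.
Proof.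
case: D1 D2 => [d1 a1 z1 m1] [d2 a2 z2 m2] /= /funext dd.
by case: _ / dd in a2 z2 m2 *; congr Derivation; exact: Prop_irrelevance.
Qed.

HB.instance Definition _ := gen_eqMixin Der.
HB.instance Definition _ := gen_choiceMixin Der.

#[local] Obligation Tactic := idtac.

Program Definition der_zero : Der := @Derivation (fun=> 0) _ _ _.
Next Obligation. by move=> f g /=; rewrite addr0. Qed.
Next Obligation. by move=> r f /=; rewrite mulr0. Qed.
Next Obligation. by move=> f g /=; rewrite mul0r mulr0 addr0. Qed.

Program Definition der_opp D : Der := @Derivation (fun f => - D f) _ _ _.
Next Obligation. by move=> D f g /=; rewrite derD opprD. Qed.
Next Obligation. by move=> D r f /=; rewrite derZ mulrN. Qed.
Next Obligation. by move=> D f g /=; rewrite derM opprD mulNr mulrN. Qed.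

Program Definition der_add D1 D2 : Der :=
  @Derivation (fun f => D1 f + D2 f) _ _ _.
Next Obligation. by move=> D1 D2 f g /=; rewrite !derD addrACA. Qed.
Next Obligation. by move=> D1 D2 r f /=; rewrite !derZ mulrDr. Qed.
Next Obligation. by move=> D1 D2 f g /=; rewrite !derM addrACA -mulrDl -mulrDr. Qed.

Program Definition der_scale (h : A) D : Der :=
  @Derivation (fun f => h * D f) _ _ _.
Next Obligation. by move=> h D f g /=; rewrite derD mulrDr. Qed.
Next Obligation. by move=> h D r f /=; rewrite derZ mulrCA. Qed.
Next Obligation. by move=> h D f g /=; rewrite derM mulrDr mulrA (mulrCA h f). Qed.

Fact der_addA : associative der_add.
Proof. by move=> D1 D2 D3; apply: der_eq => f; exact: addrA. Qed.
Fact der_addC : commutative der_add.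
Proof. by move=> D1 D2; apply: der_eq => f; exact: addrC. Qed.
Fact der_add0 : left_id der_zero der_add.
Proof. by move=> D; apply: der_eq => f; exact: add0r. Qed.
Fact der_addN : left_inverse der_zero der_opp der_add.
Proof. by move=> D; apply: der_eq => f; exact: addNr. Qed.

HB.instance Definition _ := GRing.isZmodule.Build Der
  der_addA der_addC der_add0 der_addN.

Fact der_scaleA h k D : der_scale h (der_scale k D) = der_scale (h * k) D.
Proof. by apply: der_eq => f; exact: mulrA. Qed.
Fact der_scale1 : left_id 1 der_scale.
Proof. by move=> D; apply: der_eq => f; exact: mul1r. Qed.
Fact der_scaleDr : right_distributive der_scale +%R.
Proof. by move=> h D1 D2; apply: der_eq => f; exact: mulrDr. Qed.
Fact der_scaleDl D : {morph der_scale^~ D : h k / h + k}.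
Proof. by move=> h k; apply: der_eq => f; exact: mulrDl. Qed.

HB.instance Definition _ := GRing.Zmodule_isLmodule.Build A Der
  der_scaleA der_scale1 der_scaleDr der_scaleDl.

Program Definition der_bracket D1 D2 : Der :=
  @Derivation (fun f => D1 (D2 f) - D2 (D1 f)) _ _ _.
Next Obligation. by move=> D1 D2 f g /=; rewrite !derD opprD addrACA. Qed.
Next Obligation. by move=> D1 D2 r f /=; rewrite !derZ mulrBr. Qed.
Next Obligation.
move=> D1 D2 f g /=; rewrite !(derM, derD) mulrBl mulrBr.
have addr14 (x y z t : A) : x + y + (z + t) = x + t + (y + z).
  by rewrite (addrC z) addrACA.
rewrite [X in X - _]addr14 [X in _ - X]addr14 [X in _ - (_ + X)]addrC.
by rewrite opprD addrACA subrr addr0 opprD addrACA.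
Qed.

End Derivations.

Section LeibnizPseudoalgebras.
Variables (R A : comPzRingType) (iota : {rmorphism R -> A}).

Definition is_anchored_morphism (E1 E2 : lmodType A) (a1 : E1 -> Der iota)
    (a2 : E2 -> Der iota) (phi : E1 -> E2) : Prop :=
  linear phi /\ forall x, a2 (phi x) = a1 x.

Record is_leibniz_pseudoalgebra (E : lmodType A) (a : E -> Der iota)
    (br : E -> E -> E) : Prop := {
  lp_anchor_linear : linear a;
  lp_leibniz : @is_leibniz_bracket R (restr iota E) br;
  lp_bracketZ : forall (f : A) x y, br x (f *: y) = f *: br x y + a x f *: y;
  lp_anchor_bracket : forall x y, a (br x y) = der_bracket (a x) (a y)
}.

Definition is_leibniz_pseudoalgebra_morphism (E1 E2 : lmodType A)
    (a1 : E1 -> Der iota) (br1 : E1 -> E1 -> E1)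
    (a2 : E2 -> Der iota) (br2 : E2 -> E2 -> E2) (phi : E1 -> E2) : Prop :=
  is_anchored_morphism a1 a2 phi /\
  forall x y, phi (br1 x y) = br2 (phi x) (phi y).

Definition is_free_leibniz_pseudoalgebra (M : lmodType A) (a : M -> Der iota)
    (F : lmodType A) (aF : F -> Der iota) (brF : F -> F -> F)
    (i : M -> F) : Prop :=
  [/\ is_leibniz_pseudoalgebra aF brF,
      is_anchored_morphism a aF i
    & forall (E : lmodType A) (aE : E -> Der iota) (brE : E -> E -> E),
        is_leibniz_pseudoalgebra aE brE ->
      forall phi : M -> E, is_anchored_morphism a aE phi ->
      exists! Phi : F -> E,
        is_leibniz_pseudoalgebra_morphism aF brF aE brE Phi /\
        forall m, Phi (i m) = phi m].

End LeibnizPseudoalgebras.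

Record is_module_action (A : comPzRingType) (V : zmodType)
    (act : A -> V -> V) : Prop := {
  actA : forall f g x, act f (act g x) = act (f * g) x;
  act1 : left_id 1 act;
  actDr : right_distributive act +%R;
  actDl : forall x, {morph act^~ x : f g / f + g}
}.

Definition with_action (A : comPzRingType) (V : zmodType) (act : A -> V -> V)
  (act_mod : is_module_action act) : Type := V.

Section ModuleStructures.
Variables (A : comPzRingType) (V : zmodType) (act : A -> V -> V).
Variable act_mod : is_module_action act.

HB.instance Definition _ := GRing.Zmodule.copy (with_action act_mod) V.
HB.instance Definition _ :=
  GRing.Zmodule_isLmodule.Build A (with_action act_mod)
    (actA act_mod) (act1 act_mod) (actDr act_mod) (actDl act_mod).

End ModuleStructures.

Section TensorAction.
Variables (R A : comPzRingType) (iota : {rmorphism R -> A}).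
Variables (M : lmodType A) (a : M -> Der iota).
Local Notation TM := (Tbar (restr iota M)).

Record is_tensor_action (act : A -> TM -> TM) : Prop := {
  tensor_action_module : is_module_action act;
  tensor_action_incl : forall f (m : M),
    act f (Tbar_incl (m : restr iota M)) = Tbar_incl (f *: m : restr iota M);
  tensor_action_pure : forall f (m1 m2 : restr iota M) s,
    act f (pure_tensor m1 (m2 :: s)) =
      Tbar_cons m1 (act f (pure_tensor m2 s))
      - act (a m1 f) (pure_tensor m2 s)
}.

End TensorAction.

(* Main.v *)
Require Import Defs.
From HB Require Import structures.
From mathcomp Require Import all_boot all_order all_algebra.
From mathcomp Require Import boolp.

(** The reduced tensor module TV of an R-module V has a recursion principle:
    a linear map g : V -> W and a bilinear map h : V * W -> W determine a
    unique linear F : TV -> W with F v = g v and F (v (x) x) = h v (F x)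
    ([Tbar_rec] and its equations for existence, [Tbar_ind] for uniqueness).
    Every structure of the theorem is an instance of it.

    The bracket.  If x |-> [x, -] is to be a left Leibniz bracket, it has to be
    a morphism from TV to the endomorphisms of TV with the commutator.  As
    [v, -] must be C v := (v (x) -) for v in V, this forces ad (v (x) x) to be
    the commutator of C v and ad x, which is a recursion with values in
    End(TV).  For any Leibniz algebra W and linear phi : V -> W, the recursion
    F (v (x) x) = [phi v, F x] gives F [x, y] = [F x, F y] by induction on x
    ([leibniz_extension_bracket]); this argument uses the Leibniz identity of W
    only, not the one of TV.  Taking W = End(TV) and F = ad, it says that
    ad [x, y] is the commutator of ad x and ad y, which is the Leibniz
    identity of TV.

    The A-module structure.  The orbit map f |-> f x of x is an element of
    Hom_R(A, TM), and the inductive formula for f (m (x) x) says that the orbit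
    map of m (x) x is the twisted commutator (m (x) -) o F - F o a(m) of the
    orbit map F of x.  This is again a recursion, with values in Hom_R(A, TM),
    so that well-definedness needs no separate argument.  The rule
    (f g) x = f (g x) follows by induction on x from the fact that a(m) is a
    derivation ([Tbar_actA]), and [x, f y] = f [x, y] + Fa(x)(f) y by induction
    on x, the case x in M being the definition of f (m (x) y)
    ([Tbar_bracket_act]).

    Freeness.  A morphism out of TM extending phi : M -> E is determined as a
    morphism of Leibniz R-algebras.  The extension is A-linear by induction:
    f (m (x) x) = [m, f x] - a(m)(f) x holds in TM by definition, and the same
    formula holds in E because E is a Leibniz pseudoalgebra over which phi is
    anchored ([pseudoalgebra_extension_act]).  The A-linearity of the anchor Fa
    is the same statement for E = Der A, which is a Leibniz pseudoalgebra with
    the identity as anchor. *)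

Set Implicit Arguments.
Unset Strict Implicit.
Unset Printing Implicit Defensive.

Import GRing.Theory.
Local Open Scope ring_scope.

(** * Modules of linear maps *)

Section LinearMaps.
Variables (R : comPzRingType) (U V : lmodType R).

Section LinearPredicate.
Variables (f : U -> V) (f_lin : linear f).

Definition linear_pack : {linear U -> V} :=
  HB.pack f (GRing.isLinear.Build R U V *:%R f f_lin).

Lemma linear_add x y : f (x + y) = f x + f y.
Proof. exact: (linearD linear_pack). Qed.
Lemma linear_sub x y : f (x - y) = f x - f y.
Proof. exact: (linearB linear_pack). Qed.
Lemma linear_zero : f 0 = 0.
Proof. exact: (linear0 linear_pack). Qed.
Lemma linear_scale r x : f (r *: x) = r *: f x.
Proof. exact: GRing.scalable_linear. Qed.
Lemma linear_bigsum I s (P : pred I) F :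
  f (\sum_(i <- s | P i) F i) = \sum_(i <- s | P i) f (F i).
Proof. exact: (linear_sum linear_pack). Qed.

End LinearPredicate.

(** An alias, so that the module structure below lives on it and not on the
    type of bundled linear maps itself. *)
Definition Hom := {linear U -> V}.

Lemma hom_eq (f g : Hom) : (forall x, f x = g x) -> f = g.
Proof.
case: f g => [f cf] [g cg] /= /funext fg.
case: _ / fg in cg *; case: cf cg => [[fD] [fZ]] [[gD] [gZ]].
by rewrite (Prop_irrelevance fD gD) (Prop_irrelevance fZ gZ).
Qed.

HB.instance Definition _ := gen_eqMixin Hom.
HB.instance Definition _ := gen_choiceMixin Hom.

Definition hom_zero : Hom := \0.
Definition hom_opp (f : Hom) : Hom := \- f.
Definition hom_add (f g : Hom) : Hom := f \+ g.
Definition hom_scale (r : R) (f : Hom) : Hom := r \*: f.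

Fact hom_addA : associative hom_add.
Proof. by move=> f g h; apply: hom_eq => x; exact: addrA. Qed.
Fact hom_addC : commutative hom_add.
Proof. by move=> f g; apply: hom_eq => x; exact: addrC. Qed.
Fact hom_add0 : left_id hom_zero hom_add.
Proof. by move=> f; apply: hom_eq => x; exact: add0r. Qed.
Fact hom_addN : left_inverse hom_zero hom_opp hom_add.
Proof. by move=> f; apply: hom_eq => x; exact: addNr. Qed.

HB.instance Definition _ := GRing.isZmodule.Build Hom
  hom_addA hom_addC hom_add0 hom_addN.

Fact hom_scaleA r s f : hom_scale r (hom_scale s f) = hom_scale (r * s) f.
Proof. by apply: hom_eq => x; exact: scalerA. Qed.
Fact hom_scale1 : left_id 1 hom_scale.
Proof. by move=> f; apply: hom_eq => x; exact: scale1r. Qed.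
Fact hom_scaleDr : right_distributive hom_scale +%R.
Proof. by move=> r f g; apply: hom_eq => x; exact: scalerDr. Qed.
Fact hom_scaleDl f : {morph hom_scale^~ f : r s / r + s}.
Proof. by move=> r s; apply: hom_eq => x; exact: scalerDl. Qed.

HB.instance Definition _ := GRing.Zmodule_isLmodule.Build R Hom
  hom_scaleA hom_scale1 hom_scaleDr hom_scaleDl.

End LinearMaps.

(** * Commutators of linear maps *)

(** The bookkeeping of the Jacobi identity: each letter stands for one of the
    six orders in which three operators are composed. *)
Lemma six_term_jacobi (V : zmodType) (a b c d e k : V) :
  a - b - (c - d) = a - e - (k - d) + (e - c - (b - k)).
Proof.
rewrite !opprB.
by rewrite [RHS]addrACA !subrKA addrACA [RHS]addrACA (addrC (- b)).
Qed.

Section TwistedCommutator.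
Variables (R : comPzRingType) (U V : lmodType R).

(** Endomorphisms of both source and target act on a linear map.  For U = V and
    p = q this is the usual commutator; the twisted form, with p and q acting on
    different modules, describes the action of A on tensors. *)
Definition commutator (p : Hom V V) (q : Hom U U) (f : Hom U V) : Hom U V :=
  (p \o f : Hom U V) - (f \o q : Hom U V).

Lemma commutatorE p q f x : commutator p q f x = p (f x) - f (q x).
Proof. by []. Qed.

Lemma commutator_linear p q : linear (commutator p q).
Proof.
move=> r f g; apply: hom_eq => x.
rewrite commutatorE [p _]linearP.
rewrite [RHS]/(r *: (p (f x) - f (q x)) + (p (g x) - g (q x))).
by rewrite scalerBr opprD addrACA.
Qed.

Lemma commutator_linearl (W : lmodType R)
    (p : W -> Hom V V) (q : W -> Hom U U) f :
  linear p -> linear q -> linear (fun w => commutator (p w) (q w) f).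
Proof.
move=> pL qL r w w'; apply: hom_eq => x.
rewrite commutatorE pL qL.
rewrite [RHS]/(r *: (p w (f x) - f (q w x)) + (p w' (f x) - f (q w' x))).
rewrite (_ : (r *: q w + q w' : Hom U U) x = r *: q w x + q w' x) //.
by rewrite linearP scalerBr opprD addrACA.
Qed.

End TwistedCommutator.

Lemma commutator_leibniz (R : comPzRingType) (V : lmodType R) :
  is_leibniz_bracket (fun f : Hom V V => commutator f f).
Proof.
split=> [f||f g h].
- exact: commutator_linearl.
- by move=> f; exact: commutator_linear.
apply: hom_eq => x.
rewrite [LHS]/(f (g (h x) - h (g x)) - (g (h (f x)) - h (g (f x)))).
rewrite [RHS]/(f (g (h x)) - g (f (h x)) - h (f (g x) - g (f x))
  + (g (f (h x) - h (f x)) - (f (h (g x)) - h (f (g x))))).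
rewrite (linearB f) (linearB g) (linearB h).
exact: six_term_jacobi.
Qed.

(** * Tensor products *)

Section TensorLift.
Variables (R : comPzRingType) (V W U : lmodType R) (f : V -> W -> U).
Hypothesis f_linl : forall w, linear (f^~ w).
Hypothesis f_linr : forall v, linear (f v).

Let eval (s : seq (V * W)) : U := \sum_(p <- s) f p.1 p.2.

Let eval_rel s t : tensor_rel s t -> eval s = eval t.
Proof.
elim=> [u|u w _|u w z _ + _|u u' w w' _ + _|u w|w|v v' w|v w w'|r v w] //.
- by move=> ->.
- by rewrite /eval !big_cat => -> ->.
- by rewrite /eval !big_cat /= addrC.
- by rewrite /eval big_seq1 big_nil (linear_zero (f_linl w)).
- by rewrite /eval !big_cons !big_nil !addr0 (linear_add (f_linl w)).
- by rewrite /eval !big_cons !big_nil !addr0 (linear_add (f_linr v)).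
- rewrite /eval !big_seq1 (linear_scale (f_linl w)).
  by rewrite (linear_scale (f_linr v)).
Qed.

Definition tensor_lift (x : tensor V W) : U := eval (repr x).

Let tensor_lift_mk s : tensor_lift (tensor_mk s) = eval s.
Proof. by apply/eval_rel/tensor_mkP; rewrite tensor_mkK. Qed.

Lemma tensor_lift_tens v w : tensor_lift (tens v w) = f v w.
Proof. by rewrite tensor_lift_mk /eval big_seq1. Qed.

Lemma tensor_lift_linear : linear tensor_lift.
Proof.
move=> r x y; rewrite -(tensor_mkK x) -(tensor_mkK y).
rewrite [r *: _]tensor_scale_mk [_ + _]tensor_add_mk !tensor_lift_mk.
rewrite /eval big_cat big_map /= scaler_sumr; congr (_ + _).
by apply: eq_bigr => p _; rewrite (linear_scale (f_linl _)).
Qed.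

End TensorLift.

Section Tensors.
Variables (R : comPzRingType) (V W : lmodType R).

Lemma tensor_mkD s t :
  tensor_mk s + tensor_mk t = tensor_mk (s ++ t) :> tensor V W.
Proof. exact: tensor_add_mk. Qed.

Lemma tens_scale r v w : r *: tens v w = tens (r *: v) w :> tensor V W.
Proof. exact: tensor_scale_mk. Qed.

Lemma tens_linl w : linear ((@tens R V W)^~ w).
Proof.
by move=> r v v'; rewrite tens_scale tensor_mkD; apply/tensor_mkP/tensor_addl.
Qed.

Lemma tens_linr v : linear (@tens R V W v).
Proof.
move=> r w w'; rewrite tens_scale.
rewrite (_ : tens (r *: v) w = tens v (r *: w)); last first.
  exact/tensor_mkP/tensor_balanced.
by rewrite tensor_mkD; apply/tensor_mkP/tensor_addr.
Qed.

Lemma tensor_ind (P : tensor V W -> Prop) :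
  P 0 -> (forall v w x, P x -> P (tens v w + x)) -> forall x, P x.
Proof.
move=> P0 PD x; rewrite -(tensor_mkK x); elim: (repr x) => [//|[v w] s IHs].
by have := PD v w _ IHs; rewrite tensor_mkD.
Qed.
End Tensors.

(** * Induction and recursion on the reduced tensor module *)

Section TbarInduction.
Variables (R : comPzRingType) (V : lmodType R).
Local Notation TV := (Tbar V).

Lemma TbarD (x y : TV) k : (x + y) k = x k + y k.
Proof. by []. Qed.

Lemma TbarB (x y : TV) k : (x - y) k = x k - y k.
Proof. by []. Qed.

Lemma TbarZ r (x : TV) k : (r *: x) k = r *: x k.
Proof. by []. Qed.

Lemma Tbar_incl_linear : linear (@Tbar_incl R V).
Proof. by move=> r v w; apply: dsum_eq => -[|k] //=; rewrite scaler0 addr0. Qed.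

Lemma Tbar_cons_linr v : linear (@Tbar_cons R V v).
Proof.
move=> r x y; apply: dsum_eq => -[|k] /=; last exact: tens_linr.
by rewrite scaler0 addr0.
Qed.

Lemma Tbar_cons_linl x : linear ((@Tbar_cons R V)^~ x).
Proof.
move=> r v w; apply: dsum_eq => -[|k] /=; last exact: tens_linl.
by rewrite scaler0 addr0.
Qed.

(** The homogeneous components of x are reached one at a time: every element of
    the k-th summand is the component of a tensor satisfying P whose other
    components vanish, and subtracting it from x lowers the degree bound. *)
Lemma Tbar_ind (P : TV -> Prop) :
  (forall v, P (Tbar_incl v)) -> (forall v x, P x -> P (Tbar_cons v x)) ->
  (forall x y, P x -> P y -> P (x + y)) -> forall x, P x.
Proof.
move=> P1 PS PD.
have P0 : P 0 by rewrite -(linear_zero Tbar_incl_linear).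
have Phom k t : exists y : TV, [/\ P y, y k = t & forall j, j != k -> y j = 0].
  elim: k t => [|k IHk] t; first by exists (Tbar_incl t); split=> // -[].
  elim/tensor_ind: t => [|v w _ [y [Py <- yk]]]; first by exists 0; split.
  have [z [Pz <- zk]] := IHk w; exists (Tbar_cons v z + y); split=> //.
    by apply: PD => //; exact: PS.
  move=> j jk; rewrite TbarD yk // addr0; case: j jk => [|j] //= jk.
  by rewrite zk // (linear_zero (tens_linr v)).
move=> x; have [N] := dsum_finite x; elim: N x => [|N IHN] x xN.
  by have -> : x = 0 by apply: dsum_eq => k; exact: xN.
have [y [Py yN y0]] := Phom N (x N); rewrite -(subrK y x).
apply: PD Py; apply: IHN => k; rewrite leq_eqVlt => /predU1P[<-|Nk].
  by rewrite TbarB yN subrr.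
by rewrite TbarB xN // y0 ?subr0 // gtn_eqF.
Qed.

(** The form of induction that fits data prescribed on pure tensors only. *)
Lemma Tbar_pure_ind (P : TV -> Prop) :
  (forall v s, P (pure_tensor v s)) -> (forall x y, P x -> P y -> P (x + y)) ->
  forall x, P x.
Proof.
move=> Ppure PD x.
(* The claim is proved for all predicates at once, since the step for v (x) x
   applies it to the predicate y |-> Q (v (x) y). *)
have : forall Q : TV -> Prop, (forall v s, Q (pure_tensor v s)) ->
  (forall y z, Q y -> Q z -> Q (y + z)) -> Q x; last exact.
elim/Tbar_ind: x => [v|v x IHx|x y IHx IHy] Q Qpure QD.
- exact: (Qpure v [::]).
- apply: (IHx (fun x => Q (Tbar_cons v x))) => [w s|y z Qy Qz].
    exact: (Qpure v (w :: s)).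
  by rewrite (linear_add (Tbar_cons_linr v)); exact: QD.
- by apply: (QD); [exact: IHx Qpure QD | exact: IHy Qpure QD].
Qed.

End TbarInduction.

Section TbarRecursion.
Variables (R : comPzRingType) (V W : lmodType R).
Variables (g : V -> W) (h : V -> W -> W).
Hypotheses (g_lin : linear g) (h_linl : forall w, linear (h^~ w)).
Hypothesis h_linr : forall v, linear (h v).
Local Notation TV := (Tbar V).

Fixpoint tensor_pow_rec k : tensor_pow V k -> W :=
  match k return tensor_pow V k -> W with
  | 0 => g
  | k'.+1 => tensor_lift (fun v t => h v (@tensor_pow_rec k' t))
  end.

Let step_linl k t :
  linear ((fun v t => h v (@tensor_pow_rec k t))^~ t).
Proof. by move=> r v w; rewrite h_linl. Qed.

Let step_linr k (IHk : linear (@tensor_pow_rec k)) v :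
  linear ((fun v t => h v (@tensor_pow_rec k t)) v).
Proof. by move=> r t u; rewrite IHk h_linr. Qed.

Lemma tensor_pow_rec_linear k : linear (@tensor_pow_rec k).
Proof.
elim: k => [|k IHk] //; apply: tensor_lift_linear.
- exact: step_linl.
- exact: step_linr.
Qed.

Lemma tensor_pow_rec_tens k v t :
  @tensor_pow_rec k.+1 (tens v t) = h v (@tensor_pow_rec k t).
Proof.
apply: (@tensor_lift_tens _ _ _ _ (fun v t => h v (@tensor_pow_rec k t))).
- exact: step_linl.
- by apply: step_linr; exact: tensor_pow_rec_linear.
Qed.

(** The number of terms is a chosen degree bound of x; [Tbar_recE] shows that
    any other bound gives the same sum. *)
Definition Tbar_rec (x : TV) : W :=
  \sum_(k < projT1 (cid (dsum_finite x))) tensor_pow_rec (x k).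

Let Tbar_recE N (x : TV) :
  (forall k, (N <= k)%N -> x k = 0) ->
  Tbar_rec x = \sum_(k < N) tensor_pow_rec (x k).
Proof.
have stable n m : (forall k, (n <= k)%N -> x k = 0) -> (n <= m)%N ->
    \sum_(k < m) tensor_pow_rec (x k) = \sum_(k < n) tensor_pow_rec (x k).
  move=> xn nm; rewrite -!(big_mkord xpredT (fun k => tensor_pow_rec (x k))).
  rewrite (big_cat_nat _ nm) //= [X in _ + X]big_nat.
  rewrite [X in _ + X]big1 ?addr0 // => k /andP[/xn -> _].
  by rewrite (linear_zero (@tensor_pow_rec_linear k)).
rewrite /Tbar_rec; case: cid => N' xN' /= xN.
by rewrite -(stable _ _ xN' (leq_maxl N' N)) -(stable _ _ xN (leq_maxr N' N)).
Qed.

Lemma Tbar_rec_linear : linear Tbar_rec.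
Proof.
move=> r x y; have [N xN] := dsum_finite x; have [N' yN'] := dsum_finite y.
have xM k : (maxn N N' <= k)%N -> x k = 0 by rewrite geq_max => /andP[/xN].
have yM k : (maxn N N' <= k)%N -> y k = 0 by rewrite geq_max => /andP[_ /yN'].
rewrite (Tbar_recE xM) (Tbar_recE yM) (@Tbar_recE (maxn N N')); last first.
  by move=> k Mk; rewrite TbarD TbarZ xM // yM // scaler0 addr0.
rewrite scaler_sumr -big_split; apply: eq_bigr => k _.
exact: tensor_pow_rec_linear.
Qed.

Lemma Tbar_rec_incl v : Tbar_rec (Tbar_incl v) = g v.
Proof. by rewrite (@Tbar_recE 1) ?big_ord1 // => -[]. Qed.

Lemma Tbar_rec_cons v x : Tbar_rec (Tbar_cons v x) = h v (Tbar_rec x).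
Proof.
have [N xN] := dsum_finite x.
rewrite (Tbar_recE xN) (linear_bigsum (h_linr v)) (@Tbar_recE N.+1); last first.
  by case=> // k /xN /= ->; exact: (linear_zero (tens_linr v)).
rewrite big_ord_recl [X in X + _](linear_zero g_lin) add0r.
by apply: eq_bigr => k _; exact: tensor_pow_rec_tens.
Qed.

End TbarRecursion.

(** * The universal Leibniz bracket *)

Section UniversalBracket.
Variables (R : comPzRingType) (V : lmodType R).
Local Notation TV := (Tbar V).

Definition Tbar_cons_hom (v : V) : Hom TV TV := linear_pack (Tbar_cons_linr v).

Lemma Tbar_cons_hom_linear : linear Tbar_cons_hom.
Proof. by move=> r v w; apply: hom_eq => x; exact: Tbar_cons_linl. Qed.

(** The left multiplications: the only possible choice that turns brackets into
    commutators and sends v to v (x) -. *)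
Definition Tbar_ad : TV -> Hom TV TV :=
  Tbar_rec Tbar_cons_hom
    (fun v => commutator (Tbar_cons_hom v) (Tbar_cons_hom v)).

Definition Tbar_bracket (x y : TV) : TV := Tbar_ad x y.

Let ad_linl w :
  linear (fun v => commutator (Tbar_cons_hom v) (Tbar_cons_hom v) w).
Proof. by apply: commutator_linearl; exact: Tbar_cons_hom_linear. Qed.

Let ad_linr v := commutator_linear (Tbar_cons_hom v) (Tbar_cons_hom v).

Lemma Tbar_bracket_incl v y : Tbar_bracket (Tbar_incl v) y = Tbar_cons v y.
Proof.
rewrite /Tbar_bracket /Tbar_ad.
by rewrite (Tbar_rec_incl Tbar_cons_hom_linear ad_linl ad_linr).
Qed.

Lemma Tbar_bracket_cons v x y :
  Tbar_bracket (Tbar_cons v x) y =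
  Tbar_cons v (Tbar_bracket x y) - Tbar_bracket x (Tbar_cons v y).
Proof.
rewrite /Tbar_bracket /Tbar_ad.
by rewrite (Tbar_rec_cons Tbar_cons_hom_linear ad_linl ad_linr).
Qed.

Lemma Tbar_ad_linear : linear Tbar_ad.
Proof. exact: (Tbar_rec_linear Tbar_cons_hom_linear ad_linl ad_linr). Qed.

Lemma Tbar_bracket_linl y : linear (Tbar_bracket^~ y).
Proof. by move=> r x x'; rewrite /Tbar_bracket Tbar_ad_linear. Qed.

Lemma Tbar_bracket_linr x : linear (Tbar_bracket x).
Proof. exact: linearP. Qed.

Section Extension.
Variables (W : lmodType R) (brW : W -> W -> W) (phi : V -> W).
Hypotheses (brWP : is_leibniz_bracket brW) (phi_lin : linear phi).

Definition leibniz_extension : TV -> W := Tbar_rec phi (fun v => brW (phi v)).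

Let h_linl w : linear (fun v => brW (phi v) w).
Proof. by move=> r v v'; rewrite phi_lin; exact: leibniz_linl. Qed.

Let h_linr v : linear (brW (phi v)).
Proof. exact: leibniz_linr. Qed.

Lemma leibniz_extension_incl v : leibniz_extension (Tbar_incl v) = phi v.
Proof. exact: Tbar_rec_incl. Qed.

Lemma leibniz_extension_cons v x :
  leibniz_extension (Tbar_cons v x) = brW (phi v) (leibniz_extension x).
Proof. exact: Tbar_rec_cons. Qed.

Lemma leibniz_extension_linear : linear leibniz_extension.
Proof. exact: Tbar_rec_linear. Qed.

(** Only the Leibniz identity of W enters, so this is available before that of
    [Tbar_bracket], and is used to prove it. *)
Lemma leibniz_extension_bracket x y :
  leibniz_extension (Tbar_bracket x y) =
  brW (leibniz_extension x) (leibniz_extension y).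
Proof.
elim/Tbar_ind: x y => [v|v x IHx|x x' IHx IHx'] y.
- by rewrite Tbar_bracket_incl leibniz_extension_cons leibniz_extension_incl.
- rewrite Tbar_bracket_cons (linear_sub leibniz_extension_linear).
  rewrite !leibniz_extension_cons !IHx leibniz_extension_cons.
  by rewrite (leibniz_id brWP) addrK.
- rewrite (linear_add (Tbar_bracket_linl y)).
  rewrite !(linear_add leibniz_extension_linear).
  by rewrite IHx IHx' (linear_add (leibniz_linl brWP _)).
Qed.

End Extension.

(** [Tbar_ad] is itself the extension of v |-> v (x) - to the Leibniz algebra of
    endomorphisms, hence turns brackets into commutators. *)
Lemma Tbar_bracket_leibniz : is_leibniz_bracket Tbar_bracket.
Proof.
split=> [||x y z]; [exact: Tbar_bracket_linl | exact: Tbar_bracket_linr |].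
have ad_bracket := leibniz_extension_bracket (@commutator_leibniz R TV)
  Tbar_cons_hom_linear.
have := congr1 (fun f : Hom TV TV => f z) (ad_bracket x y).
by rewrite commutatorE -/Tbar_ad /Tbar_bracket => ->; rewrite subrK.
Qed.

Lemma Tbar_bracket_universal : is_universal_leibniz_bracket Tbar_bracket.
Proof.
split=> [|v s]; first exact: Tbar_bracket_leibniz.
by elim: s v => //= w s IHs v; rewrite Tbar_bracket_incl IHs.
Qed.

Lemma universal_bracket_incl (br : TV -> TV -> TV) v y :
  is_universal_leibniz_bracket br ->
  br (Tbar_incl v) y = Tbar_cons v y.
Proof.
move=> [brL br_iter]; elim/Tbar_pure_ind: y => [w s|y z IHy IHz].
  by rewrite [in LHS]br_iter -[RHS]/(pure_tensor v (w :: s)) br_iter.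
rewrite (linear_add (leibniz_linr brL _)) (linear_add (Tbar_cons_linr v)).
by rewrite IHy IHz.
Qed.

Lemma universal_bracket_unique (br : TV -> TV -> TV) :
  is_universal_leibniz_bracket br -> br = Tbar_bracket.
Proof.
move=> brU; have [brL _] := brU; apply/funext => x; apply/funext => y.
elim/Tbar_ind: x y => [v|v x IHx|x x' IHx IHx'] y.
- by rewrite Tbar_bracket_incl universal_bracket_incl.
- rewrite Tbar_bracket_cons -!IHx -!(fun v y => universal_bracket_incl v y brU).
  by rewrite (leibniz_id brL) addrK.
- rewrite (linear_add (leibniz_linl brL y)) (linear_add (Tbar_bracket_linl y)).
  by rewrite IHx IHx'.
Qed.

(** Uniqueness in the freeness of TV: v (x) x is the bracket of v and x. *)
Lemma leibniz_morphism_eq (W : lmodType R) (brW : W -> W -> W) (F G : TV -> W) :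
  is_leibniz_morphism Tbar_bracket brW F ->
  is_leibniz_morphism Tbar_bracket brW G ->
  (forall v, F (Tbar_incl v) = G (Tbar_incl v)) -> F = G.
Proof.
move=> [F_lin F_br] [G_lin G_br] FG; apply/funext => x.
elim/Tbar_ind: x => // [v x IHx|x y IHx IHy].
  by rewrite -Tbar_bracket_incl F_br G_br FG IHx.
by rewrite (linear_add F_lin) (linear_add G_lin) IHx IHy.
Qed.

End UniversalBracket.

(** * Derivations as a Leibniz algebra *)

Section RestrictedDerivations.
Variables (R A : comPzRingType) (iota : {rmorphism R -> A}).

Lemma linear_restr (M N : lmodType A) (f : M -> N) :
  linear f -> linear (f : restr iota M -> restr iota N).
Proof. by move=> f_lin r x y; exact: f_lin. Qed.

Lemma der_linear (D : Der iota) : linear (D : restr iota A^o -> restr iota A^o).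
Proof. by move=> r f g; rewrite derD derZ. Qed.

Lemma der_iota (D : Der iota) r : D (iota r) = 0.
Proof.
suff D1 : D 1 = 0 by rewrite -(mulr1 (iota r)) derZ D1 mulr0.
by apply: (addrI (D 1)); rewrite addr0 -{3}(mulr1 1) derM mulr1 mul1r.
Qed.

Lemma derB (D : Der iota) f g : D (f - g) = D f - D g.
Proof. exact: (linear_sub (der_linear D)). Qed.

Lemma der_addE (D E : Der iota) f : (D + E) f = D f + E f.
Proof. by []. Qed.

Lemma der_scaleE h (D : Der iota) f : (h *: D) f = h * D f.
Proof. by []. Qed.

Lemma restr_derZ r (D : restr iota (Der iota)) f :
  (r *: D : restr iota (Der iota)) f = iota r * D f.
Proof. by []. Qed.

Lemma der_bracketE (D E : Der iota) f : der_bracket D E f = D (E f) - E (D f).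
Proof. by []. Qed.

Lemma der_bracket_leibniz :
  @is_leibniz_bracket R (restr iota (Der iota)) (@der_bracket R A iota).
Proof.
split=> [D r D1 D2|D r D1 D2|D E F]; apply: der_eq => f.
- rewrite der_addE restr_derZ !der_bracketE !der_addE !restr_derZ.
  by rewrite derD derZ mulrBr opprD addrACA.
- rewrite der_addE restr_derZ !der_bracketE !der_addE !restr_derZ.
  by rewrite derD derZ mulrBr opprD addrACA.
rewrite der_addE !der_bracketE !derB.
exact: six_term_jacobi.
Qed.

End RestrictedDerivations.

(** * The module structure over the algebra *)

Lemma cross_terms_cancel (V : zmodType) (a b c d e k : V) :
  a + b + (c + d) - (e + c + (b + k)) = a - e + (d - k).
Proof.
rewrite (addrACA a) [- _]opprD [LHS]addrACA !opprD; congr (_ + _).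
  by rewrite addrACA subrr addr0.
by rewrite addrACA subrr add0r.
Qed.

Section TensorActionConstruction.
Variables (R A : comPzRingType) (iota : {rmorphism R -> A}).
Variables (M : lmodType A) (a : {linear M -> Der iota}).
Local Notation rM := (restr iota M).
Local Notation rA := (restr iota A^o).
Local Notation TM := (Tbar rM).

Definition anchor_hom (m : rM) : Hom rA rA := linear_pack (der_linear (a m)).

Lemma anchor_hom_linear : linear anchor_hom.
Proof.
move=> r m n; apply: hom_eq => f.
by rewrite [LHS]/(a (iota r *: (m : M) + (n : M)) f) linearP.
Qed.

Let scale_linear (m : M) :
  linear (fun f : rA => Tbar_incl (f *: m : rM)).
Proof.
move=> r f g; rewrite -Tbar_incl_linear; congr Tbar_incl.
by rewrite [LHS]scalerDl -[in LHS]scalerA.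
Qed.

(** Orbit maps f |-> f x are the values of the recursion that defines the
    action: those of M first, then [Tbar_act_hom] for those of TM. *)
Definition incl_orbit (m : rM) : Hom rA TM := linear_pack (scale_linear m).

Let incl_orbit_linear : linear incl_orbit.
Proof.
move=> r m n; apply: hom_eq => f.
rewrite [RHS](esym (Tbar_incl_linear _ _ _)); congr Tbar_incl.
rewrite [LHS]scalerDr; congr (_ + _).
by rewrite [LHS]scalerA mulrC -scalerA.
Qed.

Definition Tbar_act_hom : TM -> Hom rA TM :=
  Tbar_rec incl_orbit (fun m => commutator (Tbar_cons_hom m) (anchor_hom m)).

Definition Tbar_act (f : A) (x : TM) : TM := Tbar_act_hom x f.

Let step_linl F :
  linear (fun m => commutator (Tbar_cons_hom m) (anchor_hom m) F).
Proof.
apply: commutator_linearl; first exact: Tbar_cons_hom_linear.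
exact: anchor_hom_linear.
Qed.

Let step_linr m := commutator_linear (Tbar_cons_hom m) (anchor_hom m).

Lemma Tbar_act_incl f m :
  Tbar_act f (Tbar_incl m) = Tbar_incl (f *: (m : M) : rM).
Proof.
rewrite /Tbar_act /Tbar_act_hom.
by rewrite (Tbar_rec_incl incl_orbit_linear step_linl step_linr).
Qed.

Lemma Tbar_act_cons f m x :
  Tbar_act f (Tbar_cons m x) = Tbar_cons m (Tbar_act f x) - Tbar_act (a m f) x.
Proof.
rewrite /Tbar_act /Tbar_act_hom.
by rewrite (Tbar_rec_cons incl_orbit_linear step_linl step_linr).
Qed.

Lemma Tbar_act_linear f : linear (Tbar_act f).
Proof.
have act_hom_linear := Tbar_rec_linear incl_orbit_linear step_linl step_linr.
by move=> r x y; rewrite /Tbar_act /Tbar_act_hom act_hom_linear.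
Qed.

Lemma Tbar_actDl f g x : Tbar_act (f + g) x = Tbar_act f x + Tbar_act g x.
Proof. exact: (linearD (Tbar_act_hom x)). Qed.

Lemma Tbar_actBl f g x : Tbar_act (f - g) x = Tbar_act f x - Tbar_act g x.
Proof. exact: (linearB (Tbar_act_hom x)). Qed.

(** An R-linear derivation kills the image of R, so scalars from R pass through
    the tensors without correction term. *)
Lemma Tbar_act_iota r x : Tbar_act (iota r) x = r *: x.
Proof.
elim/Tbar_ind: x => [m|m x IHx|x y IHx IHy].
- by rewrite Tbar_act_incl -(linear_scale (@Tbar_incl_linear R rM)).
- rewrite Tbar_act_cons IHx der_iota -(linear_scale (Tbar_cons_linr m)).
  by rewrite [X in _ - X](linear0 (Tbar_act_hom x)) subr0.
- by rewrite (linear_add (Tbar_act_linear _)) IHx IHy scalerDr.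
Qed.

(** Expanding f (g (m (x) x)) produces the correction terms a(m)(f) g x and
    f a(m)(g) x, which the product rule for a(m) collects into a(m)(f g) x. *)
Lemma Tbar_actA f g x : Tbar_act f (Tbar_act g x) = Tbar_act (f * g) x.
Proof.
elim/Tbar_ind: x f g => [m|m x IHx|x y IHx IHy] f g.
- by rewrite !Tbar_act_incl scalerA.
- rewrite !Tbar_act_cons (linear_sub (Tbar_act_linear f)) Tbar_act_cons !IHx.
  by rewrite derM Tbar_actDl opprD addrA.
- by rewrite !(linear_add (Tbar_act_linear _)) IHx IHy.
Qed.

Lemma Tbar_act_is_module_action : is_module_action Tbar_act.
Proof.
split=> [f g x|x|f x y|x f g].
- exact: Tbar_actA.
- by rewrite -(rmorph1 iota) Tbar_act_iota scale1r.
- exact: (linear_add (Tbar_act_linear f)).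
- exact: Tbar_actDl.
Qed.

Lemma Tbar_act_tensor : is_tensor_action a Tbar_act.
Proof.
split=> [|f m|f m1 m2 s]; first exact: Tbar_act_is_module_action.
- exact: Tbar_act_incl.
- exact: Tbar_act_cons.
Qed.

Lemma tensor_action_unique act : is_tensor_action a act -> act = Tbar_act.
Proof.
move=> [act_mod act_incl act_pure].
apply/funext => f; apply/funext => x.
elim/Tbar_pure_ind: x f => [m s|x y IHx IHy] f.
  elim: s m f => [|m2 s IHs] m f; first by rewrite [LHS]act_incl Tbar_act_incl.
  by rewrite act_pure !IHs [RHS]Tbar_act_cons.
by rewrite (actDr act_mod) (linear_add (Tbar_act_linear f)) IHx IHy.
Qed.

Definition Tbar_anchor : TM -> Der iota :=
  @leibniz_extension R rM (restr iota (Der iota)) (@der_bracket R A iota) a.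

Let a_linear : linear (a : rM -> restr iota (Der iota)).
Proof. by apply: linear_restr; exact: linearP. Qed.

Lemma Tbar_anchor_linear : linear (Tbar_anchor : TM -> restr iota (Der iota)).
Proof.
exact: (leibniz_extension_linear (der_bracket_leibniz iota) a_linear).
Qed.

Lemma Tbar_anchor_incl m : Tbar_anchor (Tbar_incl m) = a m.
Proof. exact: (leibniz_extension_incl (der_bracket_leibniz iota) a_linear). Qed.

Lemma Tbar_anchor_bracket x y :
  Tbar_anchor (Tbar_bracket x y) = der_bracket (Tbar_anchor x) (Tbar_anchor y).
Proof.
exact: (leibniz_extension_bracket (der_bracket_leibniz iota) a_linear).
Qed.

(** For x in M this is the definition of the action on m (x) y.  In the
    inductive step both mixed terms, carrying one derivative of f and one
    bracket, occur twice with opposite signs; what remains of the second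
    derivatives of f is the commutator of a(m) and Fa(x). *)
Lemma Tbar_bracket_act x f y :
  Tbar_bracket x (Tbar_act f y) =
  Tbar_act f (Tbar_bracket x y) + Tbar_act (Tbar_anchor x f) y.
Proof.
have cons_act m g z :
    Tbar_cons m (Tbar_act g z) =
    Tbar_act g (Tbar_cons m z) + Tbar_act (a m g) z.
  by rewrite Tbar_act_cons subrK.
have actB g z t : Tbar_act g (z - t) = Tbar_act g z - Tbar_act g t.
  exact: (linear_sub (Tbar_act_linear g)).
elim/Tbar_ind: x f y => [m|m x IHx|x x' IHx IHx'] f y.
- by rewrite !Tbar_bracket_incl Tbar_anchor_incl cons_act.
- rewrite !Tbar_bracket_cons IHx cons_act (linear_add (Tbar_cons_linr m)).
  rewrite (linear_add (Tbar_bracket_linr x)) !cons_act !IHx actB.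
  (* only the anchor of m (x) x is rewritten: Fa (m (x) x) = [a m, Fa x] *)
  rewrite -(Tbar_bracket_incl m x) Tbar_anchor_bracket Tbar_anchor_incl.
  by rewrite der_bracketE Tbar_actBl cross_terms_cancel.
- rewrite !(linear_add (Tbar_bracket_linl _)) IHx IHx'.
  rewrite (linear_add (Tbar_act_linear f)) (linear_add Tbar_anchor_linear).
  by rewrite der_addE Tbar_actDl addrACA.
Qed.

End TensorActionConstruction.

(** * Freeness *)

Section FreePseudoalgebra.
Variables (R A : comPzRingType) (iota : {rmorphism R -> A}).
Variables (M : lmodType A) (a : {linear M -> Der iota}).
Local Notation rM := (restr iota M).
Local Notation TM := (Tbar rM).
Local Notation FM := (with_action (tensor_action_module (Tbar_act_tensor a))).

(** As a target of [pseudoalgebra_extension] it makes the anchor of TM, which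
    extends a, a linear map over A. *)
Lemma der_leibniz_pseudoalgebra :
  is_leibniz_pseudoalgebra (id : Der iota -> Der iota) (@der_bracket R A iota).
Proof.
split=> // [|f D E]; first exact: der_bracket_leibniz.
apply: der_eq => g.
rewrite der_addE der_bracketE !der_scaleE der_bracketE derM mulrBr.
by rewrite -addrA addrC.
Qed.

Section Extension.
Variables (E : lmodType A) (aE : E -> Der iota) (brE : E -> E -> E).
Variable phi : M -> E.
Hypotheses (EP : is_leibniz_pseudoalgebra aE brE).
Hypothesis phiP : is_anchored_morphism a aE phi.

Let phi_linear : linear (phi : rM -> restr iota E).
Proof. by apply: linear_restr; exact: phiP.1. Qed.

Let brEP := lp_leibniz EP.

Definition pseudoalgebra_extension : TM -> E :=
  @leibniz_extension R rM (restr iota E) brE phi.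

Local Notation Phi := pseudoalgebra_extension.

Let Phi_linear : linear (Phi : TM -> restr iota E).
Proof. exact: (leibniz_extension_linear brEP phi_linear). Qed.

Lemma pseudoalgebra_extension_incl m : Phi (Tbar_incl m) = phi m.
Proof. exact: (leibniz_extension_incl brEP phi_linear). Qed.

Let Phi_bracket x y : Phi (Tbar_bracket x y) = brE (Phi x) (Phi y).
Proof. exact: (leibniz_extension_bracket brEP phi_linear). Qed.

(** In TM the formula f (m (x) x) = [m, f x] - a(m)(f) x defines the action; in
    E it is the Leibniz rule of the bracket, with a(m) the anchor of phi m. *)
Lemma pseudoalgebra_extension_act f x : Phi (Tbar_act a f x) = f *: Phi x.
Proof.
elim/Tbar_ind: x f => [m|m x IHx|x y IHx IHy] f.
- by rewrite Tbar_act_incl !pseudoalgebra_extension_incl (linear_scale phiP.1).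
- rewrite Tbar_act_cons (linear_sub Phi_linear) -!Tbar_bracket_incl.
  rewrite !Phi_bracket.
  rewrite !IHx pseudoalgebra_extension_incl (lp_bracketZ EP) phiP.2.
  exact: addrK.
- rewrite (linear_add (Tbar_act_linear a f)) !(linear_add Phi_linear) IHx IHy.
  by rewrite [RHS]scalerDr.
Qed.

(** Both sides are Leibniz morphisms to Der A extending a. *)
Lemma pseudoalgebra_extension_anchor x : aE (Phi x) = Tbar_anchor a x.
Proof.
have aE_linear : linear (aE : restr iota E -> restr iota (Der iota)).
  by apply: linear_restr; exact: lp_anchor_linear EP.
suff -> : Tbar_anchor a = aE \o Phi by [].
pose rDer : lmodType R := restr iota (Der iota).
apply: (@leibniz_morphism_eq R rM rDer (@der_bracket R A iota)).
- by split; [exact: Tbar_anchor_linear | exact: Tbar_anchor_bracket].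
- split=> [r x' y|x' y] /=; first by rewrite Phi_linear aE_linear.
  by rewrite Phi_bracket (lp_anchor_bracket EP).
- by move=> m /=; rewrite Tbar_anchor_incl pseudoalgebra_extension_incl phiP.2.
Qed.

Lemma pseudoalgebra_extension_morphism :
  is_leibniz_pseudoalgebra_morphism (E1 := FM)
    (Tbar_anchor a) (@Tbar_bracket R rM) aE brE Phi.
Proof.
split; last exact: Phi_bracket.
split; last exact: pseudoalgebra_extension_anchor.
move=> f x y; rewrite -pseudoalgebra_extension_act.
exact: (linear_add Phi_linear).
Qed.

End Extension.

(** The R-module structures of TM obtained from the direct sum and by
    restriction of the action agree, by [Tbar_act_iota]. *)
Lemma pseudoalgebra_morphism_leibniz (E : lmodType A) (aE : E -> Der iota)
    (brE : E -> E -> E) (Psi : FM -> E) :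
  is_leibniz_pseudoalgebra_morphism (E1 := FM)
    (Tbar_anchor a) (@Tbar_bracket R rM) aE brE Psi ->
  @is_leibniz_morphism R TM (restr iota E) (@Tbar_bracket R rM) brE Psi.
Proof.
move=> [[Psi_lin _] Psi_br]; split=> // r x y.
by rewrite -[in LHS](Tbar_act_iota a); exact: Psi_lin.
Qed.

Lemma Tbar_leibniz_pseudoalgebra :
  is_leibniz_pseudoalgebra (E := FM) (Tbar_anchor a) (@Tbar_bracket R rM).
Proof.
split.
- have aP : is_anchored_morphism a (id : Der iota -> Der iota) a.
    by split=> //; exact: linearP.
  have act := pseudoalgebra_extension_act der_leibniz_pseudoalgebra aP.
  move=> f x y; rewrite [LHS](linear_add (Tbar_anchor_linear a)).
  by congr (_ + _); exact: act.
- split=> [y r x x'|x r y y'|x y z].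
  + rewrite [LHS](linear_add (Tbar_bracket_linl y)); congr (_ + _).
    rewrite [X in Tbar_bracket X](Tbar_act_iota a) [RHS](Tbar_act_iota a).
    exact: (linear_scale (Tbar_bracket_linl y)).
  + rewrite [LHS](linear_add (Tbar_bracket_linr x)); congr (_ + _).
    rewrite [X in Tbar_bracket _ X](Tbar_act_iota a) [RHS](Tbar_act_iota a).
    exact: (linear_scale (Tbar_bracket_linr x)).
  + exact: (leibniz_id (@Tbar_bracket_leibniz R rM)).
- by move=> f x y; exact: Tbar_bracket_act.
- exact: Tbar_anchor_bracket.
Qed.

Lemma Tbar_free_pseudoalgebra :
  is_free_leibniz_pseudoalgebra (F := FM) a
    (Tbar_anchor a) (@Tbar_bracket R rM) (@Tbar_incl R rM).
Proof.
split; first exact: Tbar_leibniz_pseudoalgebra.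
  split=> [f m n|m]; last exact: Tbar_anchor_incl.
  rewrite [LHS](linear_add (@Tbar_incl_linear R rM)); congr (_ + _).
  by rewrite [RHS]Tbar_act_incl.
move=> E aE brE EP phi phiP.
have Phi_incl := pseudoalgebra_extension_incl EP phiP.
have PhiP := pseudoalgebra_extension_morphism EP phiP.
exists (pseudoalgebra_extension brE phi); split=> // Psi [PsiP Psi_incl].
apply: (@leibniz_morphism_eq R rM (restr iota E) brE).
- exact: pseudoalgebra_morphism_leibniz PhiP.
- exact: pseudoalgebra_morphism_leibniz PsiP.
- by move=> m; rewrite Phi_incl Psi_incl.
Qed.

End FreePseudoalgebra.

Theorem theorem2 (R A : comPzRingType) (iota : {rmorphism R -> A})
    (M : lmodType A) (a : {linear M -> Der iota}) :
  let rM : lmodType R := restr iota M in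
  let TM : lmodType R := Tbar rM in
  let rDer : lmodType R := restr iota (Der iota) in
  exists (act : A -> TM -> TM) (act_tensor : is_tensor_action a act)
         (br : TM -> TM -> TM) (Fa : TM -> Der iota),
    [/\ unique (is_tensor_action a) act,
        (forall (r : R) (x : TM), act (iota r) x = r *: x),
        unique (@is_universal_leibniz_bracket R rM) br,
        unique (fun F : TM -> Der iota =>
                  @is_leibniz_morphism R TM rDer br (@der_bracket R A iota) F
                  /\ forall m : M, F (@Tbar_incl R rM m) = a m) Fa
      & is_free_leibniz_pseudoalgebra a
          (F := with_action (tensor_action_module act_tensor))
          Fa br (@Tbar_incl R rM)].

Proof.
move=> rM TM rDer.
exists (Tbar_act a), (Tbar_act_tensor a), (@Tbar_bracket R rM), (Tbar_anchor a).
split.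
- by split=> [|act /tensor_action_unique]; first exact: Tbar_act_tensor.
- exact: Tbar_act_iota.
- split=> [|br /universal_bracket_unique //]; exact: Tbar_bracket_universal.
- split=> [|F [F_mor F_incl]].
    split=> [|m]; last exact: Tbar_anchor_incl.
    by split; [exact: Tbar_anchor_linear | exact: Tbar_anchor_bracket].
  apply: (@leibniz_morphism_eq R rM rDer (@der_bracket R A iota)) => // [|m].
    by split; [exact: Tbar_anchor_linear | exact: Tbar_anchor_bracket].
  by rewrite Tbar_anchor_incl F_incl.
- exact: Tbar_free_pseudoalgebra.
Qed.
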